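(* Let $1<\alpha<2$, $\kappa_\alpha>0$, $\nu_\alpha>0$, and $p,q\ge 0$ with $p+q=1$. For every fixed positive integer $N$, the Legendre semi-discrete scheme described in the context (spectral collocation for the one dimensional space fractional advection-diffusion equation with homogeneous Dirichlet boundary conditions) is stable, in the following sense: there is a constant $C$, depending only on $N,\alpha,\kappa_\alpha,\nu_\alpha,p,q$ (not on $T$, $f$ or $h$), such that for every $T>0$, every source $f$ continuous on $[-1,1]\times[0,T]$, every initial datum $h$ with $h(\pm1)=0$, and every solution $u_N(\cdot,t)\in\mathbb{P}_N^0$, $0\le t\le T$ (continuously differentiable in $t$), of the semi-discrete scheme, $$\|u_N(\cdot,T)\|_N\le \exp\Big(\frac{CT}{2}\Big)\Big(\|u_N(\cdot,0)\|_N^2+\int_0^T\|f(\cdot,t)\|_N^2\,\mathrm{d}t\Big)^{1/2}.$$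
   Context: Let $1<\alpha<2$. The left and right Riemann-Liouville fractional derivatives on $[-1,1]$ are $${}_{-1}D_x^{\alpha}u(x)=\frac{1}{\Gamma(2-\alpha)}\frac{\mathrm{d}^2}{\mathrm{d}x^2}\int_{-1}^x\frac{u(\xi)}{(x-\xi)^{\alpha-1}}\,\mathrm{d}\xi,\qquad {}_xD_1^{\alpha}u(x)=\frac{1}{\Gamma(2-\alpha)}\frac{\mathrm{d}^2}{\mathrm{d}x^2}\int_x^1\frac{u(\xi)}{(\xi-x)^{\alpha-1}}\,\mathrm{d}\xi,$$ and $\nabla^\alpha u=p\,{}_{-1}D_x^\alpha u+q\,{}_xD_1^\alpha u$, while $\nabla u=\partial u/\partial x$. The continuous problem is $\partial_t u=\kappa_\alpha\nabla^\alpha u-\nu_\alpha\nabla u+f$ on $(-1,1)\times(0,\infty)$, with $u(\pm1,t)=0$ and $u(x,0)=h(x)$. Let $P_N$ be the Legendre polynomial of degree $N$. The Legendre-Gauss-Lobatto points $-1=x_0<x_1<\cdots<x_N=1$ are the roots of $(1-x^2)P_N'(x)$, with quadrature weights $w_i=\frac{2}{N(N+1)}(P_N(x_i))^{-2}$, $0\le i\le N$. The discrete inner product and norm are $$(u,v)_N=\sum_{i=0}^N u(x_i)v(x_i)w_i,\qquad \|u\|_N=\sqrt{(u,u)_N}.$$ Whenever $v(\pm1)=0$, the endpoint terms $i=0,N$ of $(\nabla^\alpha u,v)_N$ are taken to be $0$ (the fractional derivatives may be singular at $\pm1$), so the sum runs over $1\le i\le N-1$. $\mathbb{P}_N^0$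 denotes the space of real polynomials of degree at most $N$ vanishing at $\pm1$. Semi-discrete scheme: find $u_N(\cdot,t)\in\mathbb{P}_N^0$ such that for all $v\in\mathbb{P}_N^0$ and all $t$, $$\Big(\frac{\partial u_N}{\partial t},v\Big)_N=\kappa_\alpha(\nabla^\alpha u_N,v)_N-\nu_\alpha(\nabla u_N,v)_N+(f,v)_N,$$ with $u_N(x_j,0)=h(x_j)$ for $j=0,\ldots,N$. *)

(* Defs.v *)
From mathcomp Require Import all_boot all_order all_algebra.
From mathcomp Require Import all_classical all_reals all_analysis.
Set Implicit Arguments.
Unset Strict Implicit.
Unset Printing Implicit Defensive.
Import Order.TTheory GRing.Theory Num.Theory.
Import numFieldNormedType.Exports.
Local Open Scope classical_set_scope.
Local Open Scope ring_scope.

Definition Gamma (R : realType) (s : R) : R :=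
  \int[lebesgue_measure]_(t in `]0, +oo[) (t `^ (s - 1) * expR (- t)).

(* The kernel has an integrable singularity at xi = x, so the integrals below
   are Lebesgue integrals; the value given to the integrand at the single point
   xi = x is irrelevant.  [derive1n] is total: the values at x = -1 and x = 1,
   where the derivative need not exist, are meaningless. *)
Definition RL_left (R : realType) (alpha : R) (u : R -> R) (x : R) : R :=
  (Gamma (2 - alpha))^-1 *
  derive1n 2 (fun y : R => \int[lebesgue_measure]_(xi in `[-1, y])
                             (u xi / (y - xi) `^ (alpha - 1))) x.

Definition RL_right (R : realType) (alpha : R) (u : R -> R) (x : R) : R :=
  (Gamma (2 - alpha))^-1 *
  derive1n 2 (fun y : R => \int[lebesgue_measure]_(xi in `[y, 1])
                             (u xi / (xi - y) `^ (alpha - 1))) x.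

Definition nabla_frac (R : realType) (alpha p q : R) (u : R -> R) (x : R) : R :=
  p * RL_left alpha u x + q * RL_right alpha u x.

(* Rodrigues' formula. *)
Definition legendre (R : realType) (N : nat) : {poly R} :=
  (2 ^+ N * N`!%:R)^-1 *: derivn N (('X ^+ 2 - 1) ^+ N).

Definition is_LGL_points (R : realType) (N : nat) (x : 'I_N.+1 -> R) : Prop :=
  [/\ x ord0 = -1,
      x ord_max = 1,
      (forall i j : 'I_N.+1, (i < j)%N -> x i < x j)
    & (forall y : R, root ((1 - 'X ^+ 2) * deriv (legendre R N)) y <->
                     exists i : 'I_N.+1, x i = y)].

Definition LGL_weight (R : realType) (N : nat) (x : 'I_N.+1 -> R)
    (i : 'I_N.+1) : R :=
  2 / (N%:R * N.+1%:R) * ((legendre R N).[x i] ^+ 2)^-1.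

(* If v vanishes at -1 and 1, the terms i = 0 and i = N are 0 whatever the
   (meaningless) endpoint values of a fractional derivative u are. *)
Definition dinner (R : realType) (N : nat) (x : 'I_N.+1 -> R)
    (u v : R -> R) : R :=
  \sum_(i < N.+1) u (x i) * v (x i) * LGL_weight x i.

Definition dnorm (R : realType) (N : nat) (x : 'I_N.+1 -> R) (u : R -> R) : R :=
  Num.sqrt (dinner x u u).

Definition inP0 (R : realType) (N : nat) (v : {poly R}) : Prop :=
  [/\ (size v <= N.+1)%N, v.[-1] = 0 & v.[1] = 0].

(* Differentiation relative to a subset I of the line (one-sided at the
   endpoints of an interval). *)
Definition diff_quotient (R : realType) (g : R -> R) (t s : R) : R :=
  (g s - g t) / (s - t).

Definition derivable_within (R : realType) (I : set R) (g : R -> R) (t : R) :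
    Prop :=
  cvg (diff_quotient g t s @[s --> within I t^']).

Definition derive_within (R : realType) (I : set R) (g : R -> R) (t : R) : R :=
  lim (diff_quotient g t s @[s --> within I t^']).

Definition C1_within (R : realType) (I : set R) (g : R -> R) : Prop :=
  (forall t : R, I t -> derivable_within I g t) /\
  {within I, continuous (derive_within I g)}.

(* For u t of bounded degree, continuous differentiability of every
   t |-> (u t).[y] is that of t |-> u t in the finite-dimensional space of
   polynomials. *)
Definition semidiscrete_solution (R : realType) (alpha kappa nu p q : R)
    (N : nat) (x : 'I_N.+1 -> R) (T : R) (f : R -> R -> R) (h : R -> R)
    (u : R -> {poly R}) : Prop :=
  [/\ (forall t : R, 0 <= t <= T -> inP0 N (u t)),
      (forall y : R, C1_within `[0, T] (fun t => (u t).[y])),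
      (forall (v : {poly R}) (t : R), inP0 N v -> 0 <= t <= T ->
         dinner x (fun y => derive_within `[0, T] (fun s => (u s).[y]) t)
                  (horner v)
         = kappa * dinner x (nabla_frac alpha p q (horner (u t))) (horner v)
           - nu * dinner x (derive1 (horner (u t))) (horner v)
           + dinner x (fun y => f y t) (horner v))
    & (forall j : 'I_N.+1, (u 0).[x j] = h (x j))].

(* Main.v *)
Require Import Defs.
From mathcomp Require Import all_boot all_order all_algebra.
From mathcomp Require Import all_classical all_reals all_analysis.
From mathcomp Require Import measurable_realfun ring lra.
Set Implicit Arguments.
Unset Strict Implicit.
Unset Printing Implicit Defensive.
Import Order.TTheory GRing.Theory Num.Theory.
Import numFieldNormedType.Exports.
Local Open Scope classical_set_scope.
Local Open Scope ring_scope.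

(** The proof is the energy method in a space of finite dimension.

    Testing the scheme with v = u_N(t) gives, for E(t) = ||u_N(t)||_N^2,
    E' = 2 (kappa (nabla^alpha u, u)_N - nu (nabla u, u)_N) + 2 (f, u)_N.
    For a fixed N, the bracket is at most C E ([energy_bound]), and
    2 (f, u)_N <= E + ||f||_N^2 ([dinner_young]).  Gronwall's inequality
    ([gronwall]) with the rate 2 C + 1 and a square root conclude.

    The bound on the bracket is where the discretisation enters.  It is a
    quadratic expression in the nodal values of u, hence is dominated by any
    positive definite quadratic form in these values, provided that:
    - the value of nabla^alpha u at an interior node depends linearly on the
      nodal values of u.  Since the derivatives are limits of possibly
      divergent quotients, this requires the actual differentiability of the
      fractional integral of a polynomial.  Expanding u in powers of
      xi - y under the integral sign turns this integral into a finite sum of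
      terms w(y) (1 + y)^g, or w(y) (1 - y)^g, with w the scaled derivatives
      of u ([fractional_integral]); such terms are smooth inside ]-1, 1[,
      with explicit derivatives, linear in w ([RL_left_poly],
      [RL_right_poly]);
    - the weights at the interior nodes are positive, that is, P_N does not
      vanish at a zero of P_N'.  The N - 1 interior nodes exhaust the zeros of
      P_N', which are therefore simple; a common zero of P_N and P_N' would
      be a zero of P_N'' by Legendre's equation ([legendre_LGL_neq0]).

    The nodes are determined by N ([LGL_unique]), so that the constant
    obtained for one family of nodes serves for all of them. *)

(** * Legendre polynomials and Legendre-Gauss-Lobatto nodes *)

Lemma derivn_mulX (R : comNzRingType) m (f : {poly R}) :
  (f * 'X)^`(m.+1) = f^`(m) *+ m.+1 + f^`(m.+1) * 'X.
Proof. by have := derivnMXaddC m f 0; rewrite addr0. Qed.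

(** With W = (X^2 - 1)^n, the identity (X^2 - 1) W' = 2 n X W is differentiated
    n + 1 times; by Leibniz's rule a factor X contributes a single term of
    lower order, so that only P = W^(n) and its first two derivatives occur. *)
Lemma rodrigues_ode (R : comNzRingType) (N : nat) :
  let P : {poly R} := (('X ^+ 2 - 1) ^+ N.+1)^`(N.+1) in
  ('X ^+ 2 - 1) * P^`()^`() + 'X * P^`() *+ 2 - P *+ (N.+1 * N.+2) = 0.
Proof.
set W : {poly R} := ('X ^+ 2 - 1) ^+ N.+1 => P.
have WE : W^`() * 'X * 'X - W^`() = (W * 'X) *+ (N.+1 * 2).
  rewrite /W deriv_exp derivB derivC subr0 derivXn /= expr1.
  by rewrite [_ ^+ N.+1]exprS; move: (_ ^+ N) => V; ring.
have := congr1 (fun f : {poly R} => f^`(N.+2)) WE.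
rewrite derivnB derivnMn !derivn_mulX -!derivSn !derivnS -/P -derivnS -/P.
move/eqP; rewrite -subr_eq0 => /eqP <-.
by clearbody P; ring.
Qed.

Lemma legendre_ode (R : realType) (N : nat) :
  ('X ^+ 2 - 1) * (legendre R N.+1)^`()^`() + 'X * (legendre R N.+1)^`() *+ 2
    - legendre R N.+1 *+ (N.+1 * N.+2) = 0.
Proof.
have := rodrigues_ode R N; rewrite /legendre; set P := derivn _ _ => H.
rewrite !derivZ -!scalerAr !scalerMnr -scalerDr -scalerBr. by rewrite H scaler0.
Qed.

Lemma size_deriv_legendre (R : realType) (N : nat) :
  (size (legendre R N)^`() <= N)%N.
Proof.
apply/leq_sizeP => j Nj; rewrite coef_deriv coefZ coef_derivn nth_default.
  by rewrite mul0rn mulr0 mul0rn.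
rewrite (leq_trans (size_poly_exp_leq _ _))//.
have -> : size ('X ^+ 2 - 1 : {poly R}) = 3 by rewrite size_XnsubC.
by rewrite /= mul2n -addnn addnS ltnS leq_add2l.
Qed.

Section LGL.
Variables (R : realType) (N : nat) (x : 'I_N.+1 -> R).
Hypotheses (N0 : (0 < N)%N) (xP : is_LGL_points x).

Lemma LGL_inj : injective x.
Proof.
case: xP => _ _ xlt _ i j xij; apply/val_inj/eqP.
by case: ltngtP => // /xlt; rewrite xij ltxx.
Qed.

Lemma LGL_ltN1 i : i != ord0 -> -1 < x i.
Proof. by case: xP => <- _ xlt _ i0; apply: xlt; rewrite lt0n. Qed.

Lemma LGL_lt1 i : i != ord_max -> x i < 1.
Proof.
case: xP => _ <- xlt _ im; apply: xlt.
by rewrite ltn_neqAle im -ltnS ltn_ord.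
Qed.

Lemma LGL_bounds i : -1 <= x i <= 1.
Proof.
have [x0 x1 _ _] := xP; apply/andP; split.
  by have [->|/LGL_ltN1/ltW//] := eqVneq i ord0; rewrite x0.
by have [->|/LGL_lt1/ltW//] := eqVneq i ord_max; rewrite x1.
Qed.

(** Otherwise every real number would be a node, even 2. *)
Lemma deriv_legendre_neq0 : (legendre R N)^`() != 0.
Proof.
apply/eqP => P0; have [_ _ _ /(_ 2)[+ _]] := xP.
rewrite P0 mulr0 root0 => /(_ isT)[i xi].
by have := LGL_bounds i; rewrite xi; lra.
Qed.

Lemma deriv_legendre_LGL i : -1 < x i < 1 -> (legendre R N)^`().[x i] = 0.
Proof.
move=> xi; have [_ _ _ /(_ (x i))[_]] := xP => /(_ (ex_intro _ i erefl)).
rewrite rootM => /orP[|/rootP//].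
by rewrite /root !hornerE => /eqP x1; nra.
Qed.

Lemma card_LGL_interior : #|[pred i | -1 < x i < 1]| = N.-1.
Proof.
have -> : #|[pred i | -1 < x i < 1]| = #|predC (pred2 ord0 (@ord_max N))|.
  apply: eq_card => i; rewrite !inE negb_or.
  have [x0 x1 _ _] := xP.
  have [->|/LGL_ltN1 ->] := eqVneq i ord0; first by rewrite x0 ltxx.
  by have [->|/LGL_lt1 ->] := eqVneq i ord_max; rewrite ?x1 ?ltxx.
have := cardC (pred2 ord0 (@ord_max N)); rewrite card2 card_ord.
rewrite -val_eqE /= eq_sym (gtn_eqF N0) add2n => -[].
by move=> H; rewrite -[in RHS]H.
Qed.

(** If P_N vanishes at the node, Legendre's equation makes it a double zero of
    P_N'.  Then P_N' / (X - x_i) still vanishes at all N - 1 interior nodes, which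
    its degree, at most N - 2, forbids. *)
Lemma legendre_LGL_neq0 i : -1 < x i < 1 -> (legendre R N).[x i] != 0.
Proof.
move=> xi; apply/eqP => Pi.
have P'i := deriv_legendre_LGL xi.
have P''i : (legendre R N)^`()^`().[x i] = 0.
  have := congr1 (horner^~ (x i)) (legendre_ode R N.-1); rewrite !prednK//.
  rewrite !(hornerD, hornerN, hornerM, hornerMn, hornerXn, hornerX, hornerC) P'i Pi => /eqP.
  rewrite !(mulr0, mul0rn, addr0, subr0) mulf_eq0 => /orP[/eqP|/eqP//]; nra.
have /factor_theorem[Q P'Q] : root (legendre R N)^`() (x i) by apply/rootP.
have Qi : Q.[x i] = 0.
  by move: P''i; rewrite P'Q derivM derivXsubC !hornerE subrr mulr0 add0r.
have Q0 : Q != 0.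
  by apply: contraNneq deriv_legendre_neq0 => Q0; rewrite P'Q Q0 mul0r.
have sQ : (size Q).+1 = size (legendre R N)^`().
  by rewrite P'Q size_Mmonic ?monicXsubC// size_XsubC addn2.
have : all (root Q) [seq x j | j in [pred j | -1 < x j < 1]].
  apply/allP => z /mapP[j]; rewrite mem_enum => xj ->; apply/rootP.
  have [->//|ij] := eqVneq j i.
  have /eqP := deriv_legendre_LGL xj; rewrite P'Q !hornerE mulf_eq0.
  by rewrite subr_eq0 (inj_eq LGL_inj) (negbTE ij) orbF => /eqP.
move=> /(max_poly_roots Q0); rewrite map_inj_uniq ?enum_uniq; last exact: LGL_inj.
move=> /(_ isT); rewrite size_image card_LGL_interior.
have := size_deriv_legendre R N; rewrite -sQ; case: N N0 => //= n _.
by rewrite ltnS ltnNge => ->.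
Qed.

Lemma LGL_weight_gt0 i : -1 < x i < 1 -> 0 < LGL_weight x i.
Proof.
move=> /legendre_LGL_neq0 Pi; rewrite /LGL_weight mulr_gt0//.
  by rewrite divr_gt0// mulr_gt0// ltr0n.
by rewrite invr_gt0 exprn_even_gt0.
Qed.

Lemma LGL_weight_ge0 i : 0 <= LGL_weight x i.
Proof.
by rewrite /LGL_weight mulr_ge0// ?divr_ge0// ?mulr_ge0// invr_ge0 sqr_ge0.
Qed.

End LGL.

(** Both families enumerate the same set increasingly. *)
Lemma LGL_unique (R : realType) (N : nat) (x y : 'I_N.+1 -> R) :
  is_LGL_points x -> is_LGL_points y -> x =1 y.
Proof.
move=> xP yP; have sorted_LGL (z : 'I_N.+1 -> R) :
    is_LGL_points z -> sorted <%R (codom z).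
  case=> _ _ zlt _; rewrite sorted_map.
  have : sorted ltn [seq val i | i <- enum 'I_N.+1].
    by rewrite val_enum_ord iota_ltn_sorted.
  rewrite sorted_map.
  by apply: sub_sorted => i j; exact: zlt.
suff xy : codom x = codom y.
  move=> i; have := congr1 (fun s => nth 0 s (enum_rank i)) xy.
  by rewrite !nth_codom enum_rankK.
apply: lt_sorted_eq; [exact: sorted_LGL..|].
have [_ _ _ xr] := xP; have [_ _ _ yr] := yP.
move=> t; apply/codomP/codomP => -[i ->].
- by have [j <-] := (yr (x i)).1 ((xr (x i)).2 (ex_intro _ i erefl)); exists j.
- by have [j <-] := (xr (y i)).1 ((yr (y i)).2 (ex_intro _ i erefl)); exists j.
Qed.

(** * Integrating a singular power *)

(** The integrand may be unbounded near the endpoints: the theorem for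
    continuous functions is applied on an increasing sequence of segments
    exhausting ]a, b[, and monotone convergence passes to the limit. *)
Lemma ge0_FTC2_oo (R : realType) (f F : R -> R) (a b : R) : a < b ->
  (forall x, a < x < b -> 0 <= f x) ->
  {in `]a, b[, continuous f} ->
  derivable_oo_LRcontinuous F a b ->
  {in `]a, b[, F^`()%classic =1 f} ->
  (\int[lebesgue_measure]_(x in `]a, b[) (f x)%:E = (F b - F a)%:E)%E.
Proof.
move=> ab f0 cf [dF Fa Fb] F'f.
(* The shift by 3 keeps the two margins from meeting, even for n = 0. *)
pose e n : R := (b - a) / n.+3%:R.
have e0 n : 0 < e n by rewrite divr_gt0// subr_gt0.
have e2 n : e n + e n < b - a.
  have : (b - a) / n.+3%:R < (b - a) / 2.
    by rewrite ltr_pM2l ?subr_gt0// ltf_pV2 ?posrE// ltr_nat.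
  by rewrite -/(e n); lra.
have elim0 : e n @[n --> \oo] --> (0 : R).
  rewrite -(mulr0 (b - a)); apply: cvgMr.
  apply: (@cvg_trans _ (((fun n => harmonic (n + 2)%N : R) n) @[n --> \oo])).
    by apply: near_eq_cvg; near=> n; rewrite /harmonic addn2.
  by rewrite cvg_shiftn; exact: cvg_harmonic.
pose I n := `[a + e n, b - e n]%classic.
have Ioo n x : I n x -> a < x < b.
  rewrite /I/= in_itv/= => /andP[ax xb]; have := e0 n; lra.
have ndI : nondecreasing_seq I.
  move=> m n mn; apply/subsetPset => x; rewrite /I/= !in_itv/=.
  have : e n <= e m by rewrite ler_pM2l ?subr_gt0// lef_pV2 ?posrE// ler_nat !ltnS.
  by lra.
have UI : \bigcup_n I n = `]a, b[%classic.
  apply/seteqP; split => [x [n _ /Ioo]|x]; first by rewrite /= in_itv.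
  rewrite /= in_itv/= => /andP[ax xb].
  have d0 : 0 < Num.min (x - a) (b - x) by rewrite lt_min !subr_gt0 ax.
  have /cvgrPdist_lt/(_ _ d0)[n _ /(_ n (leqnn n))] := elim0.
  rewrite /= sub0r normrN gtr0_norm// lt_min => /andP[? ?].
  by exists n => //; rewrite /I/= in_itv/=; lra.
have cI n : {within I n, continuous f}.
  apply: continuous_in_subspaceT => x; rewrite inE => /Ioo xab.
  by apply: cf; rewrite in_itv.
have intI n : (\int[lebesgue_measure]_(x in I n) (f x)%:E =
               (F (b - e n) - F (a + e n))%:E)%E.
  rewrite EFinB; apply: continuous_FTC2.
  - by have := e2 n; lra.
  - exact: cI.
  - have dFx x : a < x < b -> derivable F x 1 by move=> xab; apply: dF; rewrite in_itv.
    have cFx x : a < x < b -> {for x, continuous F}.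
      by move=> /dFx /derivable1_diffP/differentiable_continuous.
    split.
    + move=> x; rewrite in_itv/= => /andP[? ?]; apply: dFx; have := e0 n; lra.
    + by apply: cvg_at_right_filter; apply: cFx; have := e0 n; have := e2 n; lra.
    + by apply: cvg_at_left_filter; apply: cFx; have := e0 n; have := e2 n; lra.
  - move=> x; rewrite in_itv/= => /andP[? ?]; apply: F'f; rewrite in_itv/=.
    by have := e0 n; lra.
have cvgI : (\int[lebesgue_measure]_(x in I n) (f x)%:E)%E @[n --> \oo] -->
    (\int[lebesgue_measure]_(x in `]a, b[) (f x)%:E)%E.
  rewrite -UI.
  apply: (@ge0_nondecreasing_set_cvg_integral _ (measurableTypeR R) R I
    (EFin \o f) lebesgue_measure) => //.
  - by move=> n; exact: measurable_itv.
  - move=> n; apply/measurable_EFinP.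
    by apply: subspace_continuous_measurable_fun => //; exact: measurable_itv.
  - by move=> n x /Ioo /f0; rewrite /= lee_fin.
apply: (cvg_unique _ cvgI) => //.
rewrite (funext intI).
apply: cvg_EFin; first exact: nearW.
apply: cvgB.
- move/cvg_at_leftP : Fb; apply; split=> [n|]; first by have := e0 n; lra.
  by rewrite -[X in _ --> X]subr0; apply: cvgB => //; exact: cvg_cst.
- move/cvg_at_rightP : Fa; apply; split=> [n|]; first by have := e0 n; lra.
  by rewrite -[X in _ --> X]addr0; apply: cvgD => //; exact: cvg_cst.
Unshelve. all: by end_near. Qed.

(** The absolute value makes continuity two-sided: [powR] is 1 on negative
    bases, so t `^ g itself jumps at 0. *)
Lemma continuous_norm_powR (R : realType) (g : R) : 0 < g ->
  continuous (fun t : R => `|t| `^ g).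
Proof.
move=> g0 t; have [->|t0] := eqVneq t 0; last first.
  have nt : `|u| @[u --> t] --> `|t| by exact: norm_continuous.
  have pt : u `^ g @[u --> `|t|] --> `|t| `^ g.
    suff /derivable1_diffP/differentiable_continuous :
      derivable (fun u : R => u `^ g) (`|t| : R) 1 by [].
    by apply: derivable_powR; rewrite in_itv/= andbT normr_gt0.
  exact: (cvg_comp _ _ nt pt).
rewrite /continuous_at normr0 powR0 ?gt_eqF//.
apply/cvgrPdist_lt => d d0; have /cvgrPdist_lt/(_ _ d0) := powR_cvg0 g0.
rewrite /at_right near_withinE => -[r /= r0 rd]; exists r => //= u /= ur.
have [->|u0] := eqVneq u 0; first by rewrite normr0 powR0 ?gt_eqF// subr0 normr0.
by apply: rd; rewrite /= ?normr_gt0// sub0r normrN normr_id -normrN -sub0r.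
Qed.

Lemma is_derive_powR_affine (R : realType) (c s g z : R) : 0 < c + s * z ->
  is_derive z 1 (fun y => (c + s * y) `^ g) (g * (c + s * z) `^ (g - 1) * s).
Proof.
move=> pos.
have aff : is_derive z 1 (fun y : R => c + s * y) s.
  have -> : (fun y : R => c + s * y) = cst c + s \*: id :> (R -> R) by apply/funext.
  by apply: is_derive_eq; rewrite add0r scaler1.
have pow := is_derive1_powR g pos.
exact: (@is_derive1_comp _ (fun u : R => u `^ g) (fun y : R => c + s * y) _ _ _ pow aff).
Qed.

(** Here s is 1 or -1, so that s * (z - y) is the distance from z to y for z on
    one side of y; both fractional derivatives are handled at once. *)
Section FractionalKernel.
Variables (R : realType) (s g a b y : R).
Hypotheses (s2 : s * s = 1) (ab : a < b) (g0 : 0 < g).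
Hypothesis pos : forall z, a < z < b -> 0 < s * (z - y).
Hypothesis nng : forall z, a <= z <= b -> 0 <= s * (z - y).

Let F (z : R) : R := s / g * `|z - y| `^ g.

Let FE z : a <= z <= b -> F z = s / g * (s * (z - y)) `^ g.
Proof.
move=> zab; rewrite /F -[X in _ * X `^ _ = _]mul1r.
have <- : `|s| = 1 by apply/eqP; rewrite -sqr_norm_eq1 expr2 s2.
by rewrite -normrM ger0_norm// nng.
Qed.

Let derF z : a < z < b -> is_derive z 1 F ((s * (z - y)) `^ (g - 1)).
Proof.
move=> zab; have := pos zab; have -> : s * (z - y) = - s * y + s * z by ring.
move=> /(is_derive_powR_affine g) D.
have := is_deriveZ (s / g) D.
have -> : (s / g) *: (g * (- s * y + s * z) `^ (g - 1) * s) =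
    (- s * y + s * z) `^ (g - 1).
  rewrite -[RHS]mul1r -s2 /GRing.scale/=; field; exact: lt0r_neq0.
apply: near_eq_is_derive.
have zoo : z \in `]a, b[ by rewrite in_itv.
near=> w; have wab : a < w < b.
  suff : w \in `]a, b[ by rewrite in_itv.
  by near: w; exact: near_in_itvoo.
rewrite FE; last by case/andP: wab => /ltW-> /ltW->.
by rewrite /= /GRing.scale/=; congr (_ * _ `^ _); ring.
Unshelve. all: by end_near. Qed.

Lemma kernel_integral :
  (\int[lebesgue_measure]_(z in `]a, b[) ((s * (z - y)) `^ (g - 1))%:E =
   (s / g * ((s * (b - y)) `^ g - (s * (a - y)) `^ g))%:E)%E.
Proof.
have -> : s / g * ((s * (b - y)) `^ g - (s * (a - y)) `^ g) = F b - F a.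
  by rewrite !FE ?lexx ?(ltW ab)// mulrBr.
have cF : continuous F.
  move=> z.
  have zy : w - y @[w --> z] --> z - y by apply: cvgB => //; exact: cvg_cst.
  have cn : `|t| `^ g @[t --> z - y] --> `|z - y| `^ g.
    exact: continuous_norm_powR.
  by apply: cvgM; [exact: cvg_cst|exact: (cvg_comp _ _ zy cn)].
apply: ge0_FTC2_oo => //.
- by move=> z _; exact: powR_ge0.
- move=> z; rewrite in_itv/= => zab.
  have := pos zab; have -> : s * (z - y) = - s * y + s * z by ring.
  move=> /(is_derive_powR_affine (g - 1)) [D _].
  have /differentiable_continuous := (derivable1_diffP _ _).1 D.
  have -> : (fun w : R => (- s * y + s * w) `^ (g - 1)) =
      (fun w => (s * (w - y)) `^ (g - 1)).
    by apply/funext => w; congr (_ `^ _); ring.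
  exact.
- split.
  + by move=> z; rewrite in_itv/= => /derF [].
  + by apply: cvg_at_right_filter; exact: cF.
  + by apply: cvg_at_left_filter; exact: cF.
- by move=> z; rewrite in_itv/= => /derF zz; rewrite derive1E derive_val.
Qed.

Lemma kernel_integrable : lebesgue_measure.-integrable `[a, b]
  (fun z => ((s * (z - y)) `^ (g - 1))%:E).
Proof.
have mk : measurable_fun [set: R] (fun z => (s * (z - y)) `^ (g - 1)).
  apply: (measurableT_comp (measurable_powR (g - 1))).
  by apply: measurable_funM => //; exact: measurable_funB.
apply/integrableP; split.
  by apply/measurable_EFinP; exact: measurable_funTS.
under eq_integral do rewrite abse_EFin ger0_norm ?powR_ge0//.
rewrite -integral_itv_bndo_bndc; last by apply/measurable_EFinP/measurable_funTS.
rewrite -integral_itv_obnd_cbnd; last by apply/measurable_EFinP/measurable_funTS.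
by rewrite kernel_integral ltry.
Qed.

Lemma kernel_Rintegral :
  \int[lebesgue_measure]_(z in `[a, b]) ((s * (z - y)) `^ (g - 1)) =
  s / g * ((s * (b - y)) `^ g - (s * (a - y)) `^ g).
Proof.
have /integrableP[/measurable_EFinP mk _] := kernel_integrable.
rewrite /Rintegral -integral_itv_bndo_bndc; last first.
  apply/measurable_EFinP; apply: measurable_funS mk => //.
  exact: subset_itv_co_cc.
rewrite -integral_itv_obnd_cbnd; last first.
  apply/measurable_EFinP; apply: measurable_funS mk => //.
  exact: subset_itv_oo_cc.
by rewrite kernel_integral.
Qed.

End FractionalKernel.

(** * Fractional integrals of polynomials *)

Lemma Rintegral_sum d (T : measurableType d) (R : realType)
    (mu : {measure set T -> \bar R}) (D : set T) (mD : measurable D) I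
    (r : seq I) (h : I -> T -> R) :
  (forall i, mu.-integrable D (EFin \o h i)) ->
  \int[mu]_(x in D) (\sum_(i <- r) h i x) =
  \sum_(i <- r) \int[mu]_(x in D) h i x.
Proof.
move=> hi; elim: r => [|i r IH].
  rewrite big_nil; under eq_Rintegral do rewrite big_nil.
  by rewrite Rintegral_cst// mul0r.
rewrite big_cons -IH -RintegralD//.
  by apply: eq_Rintegral => x _; rewrite big_cons.
have := @integrable_sum _ _ _ mu D mD I r xpredT _ (fun i _ => hi i); apply: eq_integrable => // x _.
by rewrite /= -sumEFin.
Qed.

Section FractionalIntegral.
Variables (R : realType) (alpha s : R).
Hypotheses (halpha : 1 < alpha < 2) (s2 : s * s = 1).

(* alpha is not an integer, and only the term k = 0 is singular. *)
Let kneq k : k%:R + 2 - alpha - 1 != 0.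
Proof.
have /andP[a1 a2] := halpha; case: k => [|k].
  by rewrite lt_eqF// mulr0n; lra.
by rewrite gt_eqF// -addn1 natrD; have := ler0n R k; lra.
Qed.

Let kgt0 k : 0 < k%:R + 2 - alpha.
Proof. by have := ler0n R k; have /andP[a1 a2] := halpha; lra. Qed.

(** Taylor expansion of v at y.  The equality holds even at z = y, where every
    term is 0: no exponent vanishes, and the left-hand side divides by 0. *)
Lemma fractional_integrand (v : {poly R}) (n : nat) (y z : R) :
  (size v <= n)%N -> 0 <= s * (z - y) ->
  v.[z] / (s * (z - y)) `^ (alpha - 1) =
  \sum_(k < n) s ^+ k * v^`N(k).[y] * (s * (z - y)) `^ (k%:R + 2 - alpha - 1).
Proof.
move=> vn; have -> : v.[z] = v.[y + s * (s * (z - y))].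
  by congr _.[_]; rewrite mulrA s2; ring.
move: (s * (z - y)) => d d0; rewrite (nderiv_taylor_wide _ vn); last exact: mulrC.
rewrite mulr_suml; apply: eq_bigr => k _; rewrite exprMn.
rewrite mulrA (mulrC (v^`N(k).[y])) -mulrA; congr (_ * _).
move: d0; rewrite le_eqVlt => /predU1P[<-|d0].
  by rewrite !powR0 ?invr0 ?mulr0//; rewrite gt_eqF//; have /andP[a1 a2] := halpha; lra.
rewrite -powR_mulrn ?ltW// -powRB; last by rewrite (gt_eqF d0) implybT.
by congr (_ `^ _); ring.
Qed.

(** The singularity of the kernel sits at the expansion point y, so each term
    integrates to a power of the distance from y to an endpoint. *)
Lemma fractional_integral (v : {poly R}) (n : nat) (a b y : R) :
  (size v <= n)%N -> a < b ->
  (forall z, a < z < b -> 0 < s * (z - y)) ->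
  (forall z, a <= z <= b -> 0 <= s * (z - y)) ->
  \int[lebesgue_measure]_(z in `[a, b])
     (v.[z] / (s * (z - y)) `^ (alpha - 1)) =
  \sum_(k < n) s ^+ k * v^`N(k).[y] *
     (s / (k%:R + 2 - alpha) * ((s * (b - y)) `^ (k%:R + 2 - alpha) -
                                (s * (a - y)) `^ (k%:R + 2 - alpha))).
Proof.
move=> vn ab pos nng.
under eq_Rintegral => z.
  rewrite inE/= in_itv/= => zab.
  rewrite (fractional_integrand vn (nng _ zab)); over.
have ki k := kernel_integrable s2 ab (kgt0 k) pos nng.
rewrite Rintegral_sum//; last first.
  by move=> k; apply: (integrableZl _ _ (ki k)).
apply: eq_bigr => k _; rewrite RintegralZl//; last exact: ki.
by congr (_ * _); exact: kernel_Rintegral.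
Qed.

End FractionalIntegral.

(** * Riemann-Liouville derivatives of polynomials *)

Section WeightedPolynomial.
Variables (R : realType) (s : R).

(** For s = -1 (resp. s = 1), 1 - s * y is the distance from y to the left
    (resp. right) end of [-1, 1], where the left (resp. right) fractional
    integral has its fixed bound. *)
Definition polypow (w : {poly R}) (g y : R) : R := w.[y] * (1 - s * y) `^ g.

Definition dpolypow (w : {poly R}) (g y : R) : R :=
  polypow w^`() g y - s * g * polypow w (g - 1) y.

Definition ddpolypow (w : {poly R}) (g y : R) : R :=
  dpolypow w^`() g y - s * g * dpolypow w (g - 1) y.

Lemma is_derive_polypow w g y : 0 < 1 - s * y ->
  is_derive y 1 (polypow w g) (dpolypow w g y).
Proof.
rewrite -mulNr => pos; have P := is_derive_powR_affine g pos.
have D := is_deriveM (is_derive_poly w y) P.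
have -> : polypow w g = horner w \* (fun y => (1 + - s * y) `^ g).
  by apply/funext => z; rewrite /polypow -mulNr.
apply: (is_derive_eq D).
by rewrite /dpolypow /polypow /GRing.scale/= -!mulNr; ring.
Qed.

Lemma is_derive_dpolypow w g y : 0 < 1 - s * y ->
  is_derive y 1 (dpolypow w g) (ddpolypow w g y).
Proof.
move=> pos; have D1 := is_derive_polypow w^`() g pos.
have D2 := is_deriveZ (s * g) (is_derive_polypow w (g - 1) pos).
exact: (is_deriveB D1 D2).
Qed.

Lemma ddpolypow_linear g y a u v :
  ddpolypow (a *: u + v) g y = a * ddpolypow u g y + ddpolypow v g y.
Proof.
rewrite /ddpolypow /dpolypow /polypow !(derivD, derivZ, hornerD, hornerZ).
ring.
Qed.

End WeightedPolynomial.

Lemma is_derive_lincomb (R : realType) n (c : 'I_n -> R) (h : 'I_n -> R -> R)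
    (dh : 'I_n -> R) (y : R) :
  (forall i, is_derive y 1 (h i) (dh i)) ->
  is_derive y 1 (fun z => \sum_(i < n) c i * h i z) (\sum_(i < n) c i * dh i).
Proof.
move=> H; have := @is_derive_sum _ _ _ n (fun i => c i *: h i) y 1 (fun i => c i * dh i) (fun i => is_deriveZ (c i) (H i)).
by congr (is_derive _ _ _ _); apply/funext => z; rewrite fct_sumE.
Qed.

(** Equality at the point does not suffice to compare derivatives; equality on
    an open interval does, and yields it again for the derivatives, so that the
    lemma can be iterated. *)
Lemma derive1_eq_itv (R : realType) (f g dg : R -> R) (a b : R) :
  (forall y, a < y < b -> f y = g y) ->
  (forall y, a < y < b -> is_derive y 1 g (dg y)) ->
  forall y, a < y < b -> f^`()%classic y = dg y.
Proof.
move=> fg gdg y yab; rewrite derive1E; have D := gdg _ yab.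
rewrite -[RHS]derive_val; apply: near_eq_derive.
near=> z; apply: fg; suff : z \in `]a, b[ by rewrite in_itv.
by near: z; apply: near_in_itvoo; rewrite in_itv.
Unshelve. all: by end_near. Qed.

Section RiemannLiouville.
Variables (R : realType) (alpha : R).
Hypothesis halpha : 1 < alpha < 2.

(** The second derivative of the fractional integral, in closed form; its point
    is that it makes sense, and is linear in v, without any limit.  The number n
    of terms is fixed in advance so that one formula covers all polynomials of
    size at most n. *)
Definition rl_functional (s : R) (n : nat) (x : R) (v : {poly R}) : R :=
  \sum_(k < n) s ^+ k / (k%:R + 2 - alpha) *
    ddpolypow s v^`N(k) (k%:R + 2 - alpha) x.

Lemma rl_functional_linear s n x a u v :
  rl_functional s n x (a *: u + v) =
  a * rl_functional s n x u + rl_functional s n x v.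
Proof.
rewrite /rl_functional mulr_sumr -big_split; apply: eq_bigr => k _ /=.
by rewrite nderivnD nderivnZ ddpolypow_linear; ring.
Qed.

Let kgt0 (k : nat) : 0 < k%:R + 2 - alpha.
Proof. by have := ler0n R k; have /andP[a1 a2] := halpha; lra. Qed.

Lemma derive2_rl_functional s n (F : R -> R) (v : {poly R}) :
  `|s| <= 1 ->
  (forall y, -1 < y < 1 -> F y = \sum_(k < n) s ^+ k / (k%:R + 2 - alpha) *
    polypow s v^`N(k) (k%:R + 2 - alpha) y) ->
  forall x, -1 < x < 1 -> derive1n 2 F x = rl_functional s n x v.
Proof.
move=> s1 FE.
have pos y : -1 < y < 1 -> 0 < 1 - s * y.
  move=> y1; rewrite subr_gt0 (le_lt_trans (ler_norm _))// normrM.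
  rewrite (@le_lt_trans _ _ `|y|) ?ltr_norml// -[leRHS]mul1r.
  by rewrite ler_wpM2r.
have D1 := derive1_eq_itv FE (fun y y1 => is_derive_lincomb _
  (fun k => is_derive_polypow _ _ (pos y y1))).
exact: (derive1_eq_itv D1 (fun y y1 => is_derive_lincomb _
  (fun k => is_derive_dpolypow _ _ (pos y y1)))).
Qed.

Lemma RL_left_poly n x (v : {poly R}) : (size v <= n)%N -> -1 < x < 1 ->
  RL_left alpha (horner v) x =
  (Gamma (2 - alpha))^-1 * rl_functional (-1) n x v.
Proof.
move=> vn x1; rewrite /RL_left; congr (_ * _).
apply: derive2_rl_functional x1; first by rewrite normrN1.
move=> y /andP[y1 _].
have N1 : (-1) * (-1) = 1 :> R by rewrite mulrNN mulr1.
have := @fractional_integral _ alpha (-1) halpha N1 v n (-1) y y vn y1.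
under eq_Rintegral do rewrite mulN1r opprB.
move=> ->; [|by move=> z; lra|by move=> z; lra].
apply: eq_bigr => k _; rewrite subrr mulr0 powR0 ?gt_eqF//.
by rewrite /polypow (_ : -1 * (-1 - y) = 1 - -1 * y); [field; rewrite gt_eqF|ring].
Qed.

Lemma RL_right_poly n x (v : {poly R}) : (size v <= n)%N -> -1 < x < 1 ->
  RL_right alpha (horner v) x =
  (Gamma (2 - alpha))^-1 * rl_functional 1 n x v.
Proof.
move=> vn x1; rewrite /RL_right; congr (_ * _).
apply: derive2_rl_functional x1; first by rewrite normr1.
move=> y /andP[_ y1].
have := @fractional_integral _ alpha 1 halpha (mulr1 1) v n y 1 y vn y1.
under eq_Rintegral do rewrite mul1r.
move=> ->; [|by move=> z; lra|by move=> z; lra].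
apply: eq_bigr => k _; rewrite subrr mulr0 powR0 ?gt_eqF//.
by rewrite /polypow !mul1r; field; rewrite gt_eqF.
Qed.

End RiemannLiouville.

(** * A quadratic bound for the collocation operator *)

Section Lagrange.
Variables (K : fieldType) (n : nat) (x : 'I_n -> K).
Hypothesis x_inj : injective x.

Definition lagrange_poly (i : 'I_n) : {poly K} :=
  \prod_(j < n | j != i) ((x i - x j)^-1 *: ('X - (x j)%:P)).

Lemma lagrange_poly_node i k : (lagrange_poly i).[x k] = (k == i)%:R.
Proof.
rewrite horner_prod; have [->|ki] := eqVneq k i.
  rewrite big1// => j ji; rewrite hornerZ hornerXsubC mulVf//.
  by rewrite subr_eq0 (inj_eq x_inj) eq_sym.
by rewrite (bigD1 k)//= hornerZ hornerXsubC subrr mulr0 mul0r.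
Qed.

Lemma size_lagrange_poly i : (size (lagrange_poly i) <= n)%N.
Proof.
rewrite (leq_trans (size_poly_prod_leq _ _))//.
set P := fun j : 'I_n => j != i.
have cP : (#|P|.+1 = n)%N.
  have := cardC1 i; rewrite card_ord => cP.
  by rewrite [#|P|]cP prednK // (leq_ltn_trans (leq0n i)).
have : (\sum_(j < n | j != i)
   size ((x i - x j)^-1 *: ('X - (x j)%:P)) <= \sum_(j < n | j != i) 2)%N.
  by apply: leq_sum => j _; rewrite (leq_trans (size_scale_leq _ _))// size_XsubC.
rewrite sum_nat_const muln2 -addnn -ltnS -/P => le2; rewrite leq_subLR.
by apply: leq_trans le2 _; rewrite -addnS leq_add2l cP.
Qed.

Lemma lagrange_expansion (v : {poly K}) : (size v <= n)%N ->
  v = \sum_(i < n) v.[x i] *: lagrange_poly i.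
Proof.
move=> vn; apply/eqP; rewrite -subr_eq0; apply/eqP.
apply: (@roots_geq_poly_eq0 _ _ [seq x i | i <- enum 'I_n]).
- apply/allP => _ /mapP[k _ ->]; apply/rootP.
  rewrite hornerD hornerN horner_sum (bigD1 k)//= hornerZ lagrange_poly_node.
  rewrite eqxx mulr1 big1 ?addr0 ?subrr// => j jk.
  by rewrite hornerZ lagrange_poly_node eq_sym (negbTE jk) mulr0.
- by rewrite map_inj_uniq ?enum_uniq.
- rewrite size_map size_enum_ord (leq_trans (size_polyD _ _))// geq_max vn.
  rewrite size_polyN; apply: (leq_trans (size_sum _ _ _)).
  apply/bigmax_leqP => i _; rewrite (leq_trans (size_scale_leq _ _))//.
  exact: size_lagrange_poly.
Qed.

End Lagrange.

Lemma scalar_sum (K : nzRingType) (V : lmodType K) (phi : V -> K) n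
    (c : 'I_n -> K) (b : 'I_n -> V) :
  (forall a u v, phi (a *: u + v) = a * phi u + phi v) ->
  phi (\sum_(i < n) c i *: b i) = \sum_(i < n) c i * phi (b i).
Proof.
move=> lin; have phi0 : phi 0 = 0.
  have := lin 1 0 0; rewrite scaler0 addr0 mul1r => /eqP.
  by rewrite -subr_eq subrr => /eqP.
by apply: (big_rec2 (fun y z => phi y = z)) => // i y z _ <-; exact: lin.
Qed.

(** By |v_i v_j| <= (v_i^2 + v_j^2) / 2 and v_i^2 <= w_i^-1 sum_k w_k v_k^2.  An
    index with w_i = 0 is harmless when v_i = 0, which is how the endpoints of
    the interval are allowed in the sums. *)
Lemma weighted_quadratic_bound (R : realFieldType) n (M : 'I_n -> 'I_n -> R)
    (w : 'I_n -> R) : (forall i, 0 <= w i) ->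
  exists C, 0 <= C /\ forall v : 'I_n -> R, (forall i, v i != 0 -> 0 < w i) ->
    \sum_i (\sum_j M i j * v j) * v i * w i <= C * \sum_i v i * v i * w i.
Proof.
move=> w0; exists (\sum_i \sum_j w i * `|M i j| * ((w i)^-1 + (w j)^-1)).
split.
  apply: sumr_ge0 => i _; apply: sumr_ge0 => j _.
  by rewrite mulr_ge0// ?mulr_ge0// addr_ge0// invr_ge0.
move=> v vw; set E := \sum_i v i * v i * w i.
have E0 : 0 <= E by apply: sumr_ge0 => i _; rewrite mulr_ge0// -expr2 sqr_ge0.
have vE i : v i ^+ 2 <= (w i)^-1 * E.
  have [->|v0] := eqVneq (v i) 0; first by rewrite expr0n mulr_ge0// invr_ge0.
  rewrite mulrC ler_pdivlMr ?vw// expr2 /E (bigD1 i)//= lerDl.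
  by apply: sumr_ge0 => j _; rewrite mulr_ge0// -expr2 sqr_ge0.
rewrite mulr_suml; apply: ler_sum => i _.
rewrite -mulrA mulr_suml mulr_suml; apply: ler_sum => j _.
rewrite [leLHS](_ : _ = w i * (M i j * (v i * v j))); last by ring.
rewrite -!mulrA ler_wpM2l// (le_trans (ler_norm _))// normrM ler_wpM2l//.
rewrite mulrDl (le_trans _ (lerD (vE i) (vE j)))// ler_norml.
by have := sqr_ge0 (v i + v j); have := sqr_ge0 (v i - v j); nra.
Qed.

(** At an interior node the operator is a linear functional of v, hence, by
    Lagrange interpolation, a fixed linear combination of the nodal values.  At
    the two end nodes the fractional derivatives have no meaning, but v is 0. *)
Lemma energy_bound (R : realType) (alpha kappa nu p q : R) (N : nat)
    (x : 'I_N.+1 -> R) :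
  1 < alpha < 2 -> (0 < N)%N -> is_LGL_points x ->
  exists C, 0 <= C /\ forall v, inP0 N v ->
    kappa * dinner x (nabla_frac alpha p q (horner v)) (horner v) -
    nu * dinner x (derive1 (horner v)) (horner v) <=
    C * dinner x (horner v) (horner v).
Proof.
move=> halpha N0 xP.
pose phi i (v : {poly R}) :=
  kappa * (p * ((Gamma (2 - alpha))^-1 * rl_functional alpha (-1) N.+1 (x i) v) +
           q * ((Gamma (2 - alpha))^-1 * rl_functional alpha 1 N.+1 (x i) v)) -
  nu * v^`().[x i].
have phi_lin i a u v : phi i (a *: u + v) = a * phi i u + phi i v.
  rewrite /phi !rl_functional_linear derivD derivZ hornerD hornerZ.
  by move: (Gamma _)^-1 => G; ring.
have [C [C0 CP]] := weighted_quadratic_bound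
  (fun i j => phi i (lagrange_poly x j)) (LGL_weight_ge0 x).
exists C; split => // v [sv v1 v2].
have [xl xr _ _] := xP.
have vint i : v.[x i] != 0 -> -1 < x i < 1.
  have [->|/(LGL_ltN1 xP) ->] := eqVneq i ord0; first by rewrite xl v1 eqxx.
  by have [->|/(LGL_lt1 xP) ->//] := eqVneq i ord_max; rewrite xr v2 eqxx.
have := CP (fun i => v.[x i]) (fun i vi => LGL_weight_gt0 N0 xP (vint i vi)).
rewrite -/(dinner x (horner v) (horner v)); apply: le_trans.
rewrite le_eqVlt; apply/orP; left; apply/eqP.
rewrite /dinner !mulr_sumr -sumrB; apply: eq_bigr => i _.
rewrite !(mulrA kappa) !(mulrA nu) -!mulrBl.
have [->|/vint xi] := eqVneq v.[x i] 0; first by rewrite !(mulr0, mul0r) ?subrr.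
congr (_ * _ * _).
rewrite /nabla_frac (RL_left_poly halpha sv xi) (RL_right_poly halpha sv xi) -derivE -/(phi i v).
rewrite {1}(lagrange_expansion (LGL_inj xP) sv) scalar_sum//.
by apply: eq_bigr => j _; rewrite mulrC.
Qed.

(** * Gronwall inequality on a closed interval *)

Section DeriveWithin.
Variables (R : realType) (T : R) (g : R -> R).

Let I : set R := `[0, T]%classic.

Lemma derive_within_cvg t : derivable_within I g t ->
  diff_quotient g t s @[s --> within I t^'] --> derive_within I g t.
Proof. by []. Qed.

Lemma is_derive_within_oo t : 0 < t < T -> derivable_within I g t ->
  is_derive t 1 g (derive_within I g t).
Proof.
move=> t0T /derive_within_cvg D.
have {}D : h^-1 *: (g (h *: 1 + t) - g t) @[h --> (0 : R)^'] -->
    derive_within I g t.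
  move/cvgrPdist_lt : D => D; apply/cvgrPdist_lt => e e0.
  have [d /= d0 Dd] := D e e0.
  have m0 : 0 < Num.min d (Num.min t (T - t)).
    by move: t0T => /andP[t0 tT]; rewrite !lt_min d0 t0 subr_gt0.
  exists (Num.min d (Num.min t (T - t))) => //= h.
  rewrite /= sub0r normrN !lt_min => /and3P[hd ht hT] h0.
  have := Dd (h + t); rewrite /diff_quotient /GRing.scale/= mulr1 addrK mulrC.
  apply => //=.
  - by rewrite opprD addrCA subrr addr0 normrN.
  - by rewrite -subr_eq0 addrK.
  - rewrite /I /= in_itv/=; move: ht hT; rewrite !ltr_norml; lra.
by apply: DeriveDef; [apply: cvgP D|exact: cvg_lim D].
Qed.

Lemma derivable_within_continuous :
  (forall t, I t -> derivable_within I g t) -> {within I, continuous g}.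
Proof.
move=> D; apply/subspace_continuousP => t It.
have {}D := derive_within_cvg (D _ It).
have st : s - t @[s --> within I t^'] --> 0.
  rewrite -(subrr t); apply: cvgB; last exact: cvg_cst.
  apply: cvg_trans (@cvg_id _ _); apply: cvg_trans (cvg_within _) _.
  exact: cvg_within.
have : diff_quotient g t s * (s - t) + g t @[s --> within I t^'] --> g t.
  rewrite -[X in _ --> X]add0r -(mulr0 (derive_within I g t)).
  by apply: cvgD; [exact: cvgM|exact: cvg_cst].
move=> /cvgrPdist_lt gt; apply/cvgrPdist_lt => e e0.
have [d /= d0 Dd] := gt e e0.
exists d => //= s sd Is.
have [->|st'] := eqVneq s t; first by rewrite subrr normr0.
have := Dd s sd st' Is.
by rewrite /= /diff_quotient mulfVK ?subr_eq0// subrK.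
Qed.

End DeriveWithin.

(** The function exp(- C t) E(t) - int_0^t phi has a nonpositive derivative
    inside the interval, since exp(- C t) <= 1 and phi >= 0; it is therefore
    nonincreasing, up to the endpoints by continuity. *)
Lemma gronwall (R : realType) (T C : R) (E dE phi : R -> R) :
  0 < T -> 0 <= C ->
  {within `[0, T], continuous E} ->
  {within `[0, T], continuous phi} ->
  (forall t, 0 < t < T -> is_derive t 1 E (dE t)) ->
  (forall t, 0 < t < T -> 0 <= phi t) ->
  (forall t, 0 < t < T -> dE t <= C * E t + phi t) ->
  E T <= expR (C * T) * (E 0 + \int[lebesgue_measure]_(t in `[0, T]) phi t).
Proof.
move=> T0 C0 cE cphi DE phi0 dEle.
pose w (t : R) : R := expR (- C * t).
pose G (t : R) : R := \int[lebesgue_measure]_(s in `[0, t]) phi s.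
pose F (t : R) : R := w t * E t - G t.
have iphi : lebesgue_measure.-integrable `[0, T] (EFin \o phi).
  by apply: continuous_compact_integrable => //; exact: segment_compact.
have DG (t : R) : 0 < t < T -> is_derive t 1 G (phi t).
  move=> /andP[t0 tT].
  have cphit : {for t, continuous phi}.
    have /continuous_within_itvP := cphi.
    by move=> /(_ T0)[+ _ _]; apply; rewrite in_itv/= t0.
  have [dG G'] := continuous_FTC1_closed tT iphi t0 cphit.
  by apply: DeriveDef => //; rewrite -derive1E.
have Dw (t : R) : is_derive t 1 w (- C * w t).
  have D1 : is_derive t 1 (fun s : R => - C * s) (- C).
    have -> : (fun s : R => - C * s) = - C \*: id :> (R -> R) by apply/funext.
    by apply: is_derive_eq; rewrite scaler1.
  have := @is_derive1_comp _ expR (fun s : R => - C * s) _ _ _ (is_derive_expR _) D1.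
  by rewrite mulrC.
have DF (t : R) : 0 < t < T -> is_derive t 1 F (w t *: dE t + E t *: (- C * w t) - phi t).
  move=> t0T; have D1 := DE t t0T; have D2 := DG t t0T.
  exact: (is_deriveB (is_deriveM (Dw t) D1) D2).
have cF : {within `[0, T], continuous F}.
  have cG : {within `[0, T], continuous G}.
    exact: (parameterized_integral_continuous (ltW T0) iphi).
  have cw : {within `[0, T], continuous w}.
    apply: continuous_subspaceT => t.
    by have [/derivable1_diffP/differentiable_continuous] := Dw t.
  move=> t; apply: cvgB; last exact: cG.
  by apply: cvgM; [exact: cw|exact: cE].
have FT : F T <= F 0.
  apply: (@ler0_derive1_le_cc _ F 0 T); rewrite ?in_itv/= ?lexx ?ltW//.
  - by move=> t; rewrite in_itv/= => /DF[].
  - move=> t; rewrite in_itv/= => t0T; have D1 := DF t t0T.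
    rewrite derive1E derive_val /GRing.scale/=.
    have w0 : 0 < w t by exact: expR_gt0.
    have w1 : w t <= 1.
      rewrite -expR0 ler_expR mulNr oppr_le0 mulr_ge0//.
      by case/andP: t0T => /ltW.
    have := dEle t t0T; have := phi0 t t0T; nra.
move: FT; rewrite /F /G set_itv1 Rintegral_set1 subr0 /w mulr0 expR0 mul1r.
by rewrite lerBlDr mulNr expRN -ler_pdivlMl ?invr_gt0 ?expR_gt0// invrK.
Qed.

(** * The energy estimate *)

Lemma dinner_ge0 (R : realType) (N : nat) (x : 'I_N.+1 -> R) (u : R -> R) :
  0 <= dinner x u u.
Proof.
apply: sumr_ge0 => i _; apply: mulr_ge0; last exact: LGL_weight_ge0.
by rewrite -expr2 sqr_ge0.
Qed.

Lemma sqr_dnorm (R : realType) (N : nat) (x : 'I_N.+1 -> R) (u : R -> R) :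
  dnorm x u ^+ 2 = dinner x u u.
Proof. by rewrite /dnorm sqr_sqrtr// dinner_ge0. Qed.

Lemma dinner_young (R : realType) (N : nat) (x : 'I_N.+1 -> R) (u v : R -> R) :
  2 * dinner x u v <= dinner x u u + dinner x v v.
Proof.
rewrite /dinner mulr_sumr -big_split; apply: ler_sum => i _ /=.
rewrite mulrA -mulrDl ler_wpM2r ?LGL_weight_ge0//.
by have := sqr_ge0 (u (x i) - v (x i)); nra.
Qed.

Lemma dinner_continuous (R : realType) (N : nat) (x : 'I_N.+1 -> R) (A : set R)
    (g : R -> R -> R) :
  (forall i, {within A, continuous (g (x i))}) ->
  {within A, continuous (fun t => dinner x (g^~ t) (g^~ t))}.
Proof.
move=> cg; apply: continuous_big => [|i _ t]; first exact: add_continuous.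
by apply: cvgM; [apply: cvgM; exact: cg|exact: cvg_cst].
Qed.

Lemma is_derive_dinner (R : realType) (N : nat) (x : 'I_N.+1 -> R)
    (g : R -> R -> R) (dg : R -> R) (t : R) :
  (forall i, is_derive t 1 (g (x i)) (dg (x i))) ->
  is_derive t 1 (fun s => dinner x (g^~ s) (g^~ s)) (2 * dinner x dg (g^~ t)).
Proof.
move=> Dg; have D i := is_deriveM (Dg i) (Dg i).
have := is_derive_lincomb (LGL_weight x) D.
have -> : (fun s => dinner x (g^~ s) (g^~ s)) =
   (fun z => \sum_(i < N.+1) LGL_weight x i * (g (x i) * g (x i)) z).
  by apply/funext => s; apply: eq_bigr => i _; rewrite mulrC.
move=> H; apply: (is_derive_eq H).
rewrite /dinner mulr_sumr; apply: eq_bigr => i _; rewrite /GRing.scale/=; ring.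
Qed.

Theorem theorem1 (R : realType) (alpha kappa nu p q : R) (N : nat)
    (halpha : 1 < alpha < 2) (hkappa : 0 < kappa) (hnu : 0 < nu)
    (hp : 0 <= p) (hq : 0 <= q) (hpq : p + q = 1) (hN : (0 < N)%N) :
  exists C : R,
    forall x : 'I_N.+1 -> R, is_LGL_points x ->
    forall T : R, 0 < T ->
    forall f : R -> R -> R,
      {within [set z : R * R | -1 <= z.1 <= 1 /\ 0 <= z.2 <= T],
         continuous (fun z : R * R => f z.1 z.2)} ->
    forall h : R -> R, h (-1) = 0 -> h 1 = 0 ->
    forall u : R -> {poly R},
      semidiscrete_solution alpha kappa nu p q x T f h u ->
      dnorm x (horner (u T)) <=
        expR (C * T / 2) *
        Num.sqrt (dnorm x (horner (u 0)) ^+ 2 +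
                  \int[lebesgue_measure]_(t in `[0, T])
                     (dnorm x (fun y => f y t) ^+ 2)).
Proof.
(* The constant comes from one family of nodes, chosen before x is given. *)
have [[x0 x0P]|nox] := pselect (exists x : 'I_N.+1 -> R, is_LGL_points x);
  last by exists 0 => x xP; case: nox; exists x.
have [C [C0 CP]] := energy_bound kappa nu p q halpha hN x0P.
exists (2 * C + 1) => x xP T T0 f cf h _ _ u [uP0 uC1 ueq _].
have xx0 : x0 = x by apply/funext; exact: LGL_unique.
rewrite {x0 x0P}xx0 in CP.
pose E t := dinner x (horner (u t)) (horner (u t)).
pose phi t := dinner x (f^~ t) (f^~ t).
pose du t y := derive_within `[0, T] (fun s => (u s).[y]) t.
(* At the ends of [0, T] the time derivatives are one-sided: only continuity
   is used there. *)
have cphi : {within `[0, T], continuous phi}.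
  apply: dinner_continuous => i; move/subspace_continuousP : cf => cf.
  apply/subspace_continuousP => t; rewrite /= in_itv/= => tI.
  have xi := LGL_bounds xP i.
  have slice : (x i, s) @[s --> within `[0, T] (nbhs t)] `=>`
      within [set z : R * R | -1 <= z.1 <= 1 /\ 0 <= z.2 <= T] (nbhs (x i, t)).
    move=> B [[B1 B2] /= [nB1 nB2] sB].
    change (\forall s \near within `[0, T] (nbhs t), B (x i, s)).
    rewrite near_withinE; near=> s => sI.
    apply: (sB (x i, s)); last by rewrite /= in_itv/= in sI.
    by split => /=; [exact: nbhs_singleton|near: s].
  exact: (cvg_comp _ _ slice (cf (x i, t) (conj xi tI))).
have cE : {within `[0, T], continuous E}.
  apply: (@dinner_continuous _ _ _ _ (fun y t => (u t).[y])) => i.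
  by apply: derivable_within_continuous => t; exact: (uC1 (x i)).1.
have DE (t : R) : 0 < t < T -> is_derive t 1 E (2 * dinner x (du t) (horner (u t))).
  move=> t0T; apply: (@is_derive_dinner _ _ _ (fun y t => (u t).[y])) => i.
  apply: is_derive_within_oo => //; apply: (uC1 (x i)).1.
  by rewrite /= in_itv/=; case/andP: t0T => /ltW -> /ltW ->.
have dEle (t : R) : 0 < t < T ->
    2 * dinner x (du t) (horner (u t)) <= (2 * C + 1) * E t + phi t.
  move=> /andP[/ltW t0 /ltW tT].
  have tI : 0 <= t <= T by rewrite t0.
  rewrite /du (ueq _ _ (uP0 t tI) tI).
  have := CP _ (uP0 t tI); have := dinner_young x (f^~ t) (horner (u t)).
  by rewrite -/(E t) -/(phi t); lra.
have C1 : 0 <= 2 * C + 1 by lra.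
have le := gronwall T0 C1 cE cphi DE (fun t _ => dinner_ge0 x (f^~ t)) dEle.
rewrite sqr_dnorm {1}/dnorm -/(E T) -/(E 0).
under eq_Rintegral do rewrite sqr_dnorm.
have -> : expR ((2 * C + 1) * T / 2) = Num.sqrt (expR ((2 * C + 1) * T)).
  rewrite -[LHS]ger0_norm ?expR_ge0// -sqrtr_sqr -expRM_natl.
  by congr (Num.sqrt (expR _)); field.
by rewrite -sqrtrM ?expR_ge0// ler_wsqrtr.
Unshelve. all: by end_near. Qed.
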